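(* Let $J \subseteq [0,1]$ be any closed interval and let $\varepsilon > 0$ be a small positive number. Let $h$ be a gauge function and let $C \sim \{I_j\}$ be a Cantor set with gaps $G_j$ and associated Cantor measure $\nu$. Assume the following. (i) For any fixed $w$ and all small enough $\delta$ with $I(w,\delta) \subseteq (1+\varepsilon) J$, the function $h$ is twice differentiable at $(w,\delta)$ and $$-h_{11}(w,\delta) + 4h_{22}(w,\delta) \leq 0 \qquad\text{and}\qquad h_{11}(w,\delta) + 4h_{12}(w,\delta) + 4h_{22}(w,\delta) \leq 0 .$$ (ii) For all long enough binary words $j$ with $I_j \subseteq (1+\varepsilon) J$ and all $m \in \mathbb{N}$, $$\frac{1}{2^m} \leq \frac{|G_j \cup I_{j10^m}|}{|G_j \cup I_{j1}|}.$$ (iii) $q$ and $r$ are two positive numbers such that for all long enough binary words $j$ with $I_j \subseteq (1+\varepsilon) J$, $$q \cdot \nu(I_j) \leq h(I_j) \leq r \cdot \nu(I_j).$$ Then $$\bigl(q - (r-q)\bigr)\cdot \nu(J) \leq \mu_h(J \cap C) \leq r \cdot \nu(J).$$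
   Context: Intervals. $I(w,\delta)$ denotes the interval with midpoint $w$ and diameter $\delta$. For $I = I(w,\delta)$ write $h(I) = h(w,\delta)$, and for $a>0$ write $aI = I(w,a\delta)$. $|A|$ denotes the diameter of $A$. Gauge function. A gauge function is a continuous function $h:\mathbb{R}\times\mathbb{R}_+ \to \mathbb{R}_+$ with $\lim_{\delta\to 0} h(w,\delta)=0$ for all $w \in \mathbb{R}$ which is increasing as an interval function, i.e. $I \subseteq I'$ implies $h(I)\le h(I')$. Subindices denote partial derivatives, index 1 referring to $w$ and index 2 to $\delta$: $h_{11} = \partial^2 h/\partial w^2$, $h_{12} = \partial^2 h/\partial w\,\partial\delta$, $h_{22} = \partial^2 h/\partial\delta^2$. Hausdorff measure. For $E \subseteq \mathbb{R}$, $$\mu_h(E) = \lim_{\delta \to 0} \inf\Bigl\{ \sum_k h(w_k,\delta_k) : \{I(w_k,\delta_k)\}_k \text{ is a } \delta\text{-covering of } E \Bigr\},$$ where a $\delta$-covering of $E$ is an at most countable collection of intervals of diameter at most $\delta$ whose union contains $E$ (taking the intervals open or closed gives the same measure). Cantor set. Binary words $j$ are finite words in $\{0,1\}$ (including the empty word), $|j|$ is the length of the word $j$, juxtaposition denotes concatenation, and $0^m$ is the word consisting of $m$ zeros. Let $\{I_j\}$ be a family of nonempty closed bounded intervals indexed by all binary words such that for every $j$: $I_{j0}\cap I_{j1}=\emptyset$; $I_{j0}\cup I_{j1}\subseteq I_j$; $I_{j0}$ and $I_j$ have the same left endpoint, and $I_{j1}$ and $I_j$ have the same right endpoint. Put $C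 = \bigcap_{k\ge 0}\bigcup_{|j|=k} I_j$. Cantor sets are by convention compact, perfect and totally disconnected (so $\max_{|j|=k}|I_j|\to 0$ as $k\to\infty$). One then writes $C\sim\{I_j\}$. The gap $G_j$ is the open interval $I_j\setminus(I_{j0}\cup I_{j1})$. Cantor measure. $\nu$ is the unique Borel probability measure, supported on $C$, with $\nu(I_{j0})=\nu(I_{j1})=\tfrac12\nu(I_j)$ for all binary words $j$ (so $\nu(I_j)=2^{-|j|}$). ''For all long enough binary words $j$'' means: there is $k_0$ such that the statement holds for all $j$ with $|j|\ge k_0$.
   Formalization: In (i), ''all small enough δ'' is taken with one threshold valid for all w; if the threshold may depend on w the claim is false (a gauge equal to δ^s except on intervals centred in the middle of gaps, with q = r = 1, gives μ_h(C) < 1). *)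

(* Defs.v *)
From HB Require Import structures.
From mathcomp Require Import all_boot all_order all_algebra.
From mathcomp Require Import all_classical all_reals all_analysis.

Set Implicit Arguments.
Unset Strict Implicit.
Unset Printing Implicit Defensive.

Import Order.TTheory GRing.Theory Num.Theory.
Import numFieldNormedType.Exports.

Local Open Scope classical_set_scope.
Local Open Scope ring_scope.

(* A nonempty bounded closed interval I(w, delta) is represented by the pair
   p = (w, delta) of its midpoint and its diameter, where 0 <= delta; interval
   functions are functions of such pairs.  For delta < 0, [ival] is empty:
   every definition below carries the side condition 0 <= p.2. *)
Definition lend (R : realType) (p : R * R) : R := p.1 - p.2 / 2.

Definition rend (R : realType) (p : R * R) : R := p.1 + p.2 / 2.

Definition ival (R : realType) (p : R * R) : set R := `[lend p, rend p].

Definition dilate (R : realType) (a : R) (p : R * R) : R * R := (p.1, a * p.2).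

(* [sup] is meaningful here for nonempty bounded sets only. *)
Definition diam (R : realType) (A : set R) : R :=
  sup [set z | exists x y, [/\ A x, A y & z = `|x - y|]].

(* R_+ is [0, +oo[: the domain is the half-plane 0 <= delta, on which continuity
   and the limit at 0 force h (w, 0) = 0.  The values of h at delta < 0 are
   junk and are never constrained. *)
Record gauge (R : realType) (h : R * R -> R) : Prop := Gauge {
  gauge_continuous : {within [set p | 0 <= p.2], continuous h};
  gauge_ge0 : forall p, 0 <= p.2 -> 0 <= h p;
  gauge_cvg0 : forall w, h (w, delta) @[delta --> 0^'+] --> 0;
  gauge_increasing : forall p p', 0 <= p.2 -> 0 <= p'.2 ->
    ival p `<=` ival p' -> h p <= h p'
}.

Definition partial1 (R : realType) (h : R * R -> R) : R * R -> R :=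
  fun p => derive h p (1, 0).

Definition partial2 (R : realType) (h : R * R -> R) : R * R -> R :=
  fun p => derive h p (0, 1).

(* Frechet sense; differentiability of the derivative at p is expressed through
   its two components. *)
Definition twice_differentiable (R : realType) (h : R * R -> R) (p : R * R) :=
  [/\ \forall p' \near p, differentiable h p',
      differentiable (partial1 h) p & differentiable (partial2 h) p].

(* A covering is indexed by an arbitrary set D of naturals, so it may be finite;
   the intervals are closed. *)
Definition is_covering (R : realType) (delta : R) (E : set R)
    (D : set nat) (V : nat -> R * R) :=
  (forall k, D k -> 0 <= (V k).2 <= delta) /\
  E `<=` \bigcup_(k in D) ival (V k).

Definition hausdorff_content (R : realType) (h : R * R -> R) (delta : R)
    (E : set R) : \bar R :=
  ereal_inf [set s | exists D V, is_covering delta E D V /\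
                                 s = \esum_(k in D) (h (V k))%:E].

(* The content is nonincreasing in delta, so the limit exists in \bar R. *)
Definition hausdorff_measure (R : realType) (h : R * R -> R) (E : set R)
    : \bar R :=
  lim (hausdorff_content h delta E @[delta --> 0^'+]).

(* Binary words: false is the letter 0, true the letter 1; a letter is appended
   on the right. *)
Notation word := (seq bool).

Definition cantor_of (R : realType) (I : word -> R * R) : set R :=
  \bigcap_k \bigcup_(j in [set j : word | size j = k]) ival (I j).

(* C ~ {I_j} *)
Record cantor_family (R : realType) (C : set R) (I : word -> R * R) : Prop :=
  CantorFamily {
  cantor_nonempty : forall j, 0 <= (I j).2;
  cantor_disjoint : forall j,
    ival (I (rcons j false)) `&` ival (I (rcons j true)) = set0;
  cantor_nested : forall j,
    ival (I (rcons j false)) `|` ival (I (rcons j true)) `<=` ival (I j);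
  cantor_left : forall j, lend (I (rcons j false)) = lend (I j);
  cantor_right : forall j, rend (I (rcons j true)) = rend (I j);
  cantor_eq : C = cantor_of I;
  cantor_compact : compact C;
  cantor_perfect : perfect_set C;
  cantor_totally_disconnected : totally_disconnected C
}.

Definition gap (R : realType) (I : word -> R * R) (j : word) : set R :=
  ival (I j) `\` (ival (I (rcons j false)) `|` ival (I (rcons j true))).

Record cantor_measure (R : realType) (C : set R) (I : word -> R * R)
    (nu : probability (measurableTypeR R) R) : Prop := CantorMeasure {
  cantor_measure_support : nu (~` C) = 0%E;
  cantor_measure_left : forall j,
    nu (ival (I (rcons j false))) = ((2^-1)%:E * nu (ival (I j)))%E;
  cantor_measure_right : forall j,
    nu (ival (I (rcons j true))) = ((2^-1)%:E * nu (ival (I j)))%E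
}.

Definition for_long_words (P : word -> Prop) : Prop :=
  exists k0 : nat, forall j : word, (k0 <= size j)%N -> P j.

(* Main.v *)
(* In terms of the endpoints, H(a, b) = h([a, b]), hypothesis (i) says H_ab >= 0
   and H_bb <= 0: h is strongly subadditive on overlapping intervals, and it is
   concave in the right endpoint.  Let I_j = [x, y], I_{j0} = [x, c],
   I_{j1} = [d, y] and kappa = 2 q - r.
   Strong subadditivity gives h([a, y]) >= h(I_j) - h(I_{j0}) + h([a, c]) for a in
   I_{j0}, and h(I_j) - h(I_{j0}) >= kappa nu(I_{j1}); descending the tree yields
   h([a, y]) >= kappa nu([a, y]).  For b in I_{j1}, concavity gives
   h([x, b]) - h(I_{j0}) >= (b - c) / (y - c) * kappa nu(I_{j1}), and (ii) bounds
   (b - c) / (y - c) below by nu([d, b]) / nu(I_{j1}).  A last use of strong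
   subadditivity, on [a, b] and I_{j0}, gives h([a, b]) >= kappa nu([a, b]), and
   the lower bound is the mass distribution principle.  The upper bound comes from
   the coverings by the intervals I_j of a given level. *)
Require Import Defs.
From HB Require Import structures.
From mathcomp Require Import all_boot all_order all_algebra.
From mathcomp Require Import all_classical all_reals all_analysis.
From mathcomp Require Import ring lra.

Set Implicit Arguments.
Unset Strict Implicit.
Unset Printing Implicit Defensive.

Import Order.TTheory GRing.Theory Num.Theory.
Import numFieldNormedType.Exports.

Local Open Scope classical_set_scope.
Local Open Scope ring_scope.

(** * Strong subadditivity and concavity *)

Lemma is_derive_line (R : realType) (h : R * R -> R) (p v : R * R) (t : R) :
  differentiable h (t *: v + p) ->
  is_derive t 1 (fun s => h (s *: v + p)) ('D_v h (t *: v + p)).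
Proof.
move=> dh; have dv : derivable h (t *: v + p) v by exact: diff_derivable.
have E : (fun s : R => s^-1 *:
    (((fun s => h (s *: v + p)) \o shift t) (s *: 1) - h (t *: v + p))) =
    fun s : R => s^-1 *: ((h \o shift (t *: v + p)) (s *: v) - h (t *: v + p)).
  apply/funext => s; rewrite /= addrA -scalerDl.
  by rewrite [s%:A]mulr1.
by split; [rewrite /derivable E | rewrite /derive E].
Qed.

Lemma derive_pair (R : realType) (h : R * R -> R) (p : R * R) (a b : R) :
  differentiable h p ->
  'D_(a, b) h p = a * partial1 h p + b * partial2 h p.
Proof.
move=> dh; rewrite /partial1 /partial2 !deriveE //.
have -> : (a, b) = a *: (1, 0) + b *: (0, 1) :> R * R.
  by congr pair; rewrite /= [_%:A]mulr1 [_ *: 0]mulr0 ?addr0 ?add0r.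
by rewrite linearD !linearZ.
Qed.

Lemma differentiable_bound (R : realType) (k : R * R -> R) (p : R * R) (e : R) :
  differentiable k p -> 0 < e ->
  exists2 d : R, 0 < d & forall w : R * R, `|w| < d ->
    `|k (w + p) - k p - 'd k p w| <= e * `|w|.
Proof.
move=> dk e0.
have /eqaddoP/(_ _ e0)/nbhs_norm0P[d /= d0 H] := diff_locally dk.
exists d => // w wd; have := H w wd.
by rewrite !fctE /= opprD addrA.
Qed.

(** The mean value theorem in direction [u], applied to the difference of [h] along two parallel
    segments, reduces the second difference to an increment of ['D_u h], which the differential of
    ['D_u h] at [p] controls. Since ['D_u h] is assumed differentiable at [p] only, a second mean
    value theorem is not possible. *)
Lemma second_difference_bound (R : realType) (h : R * R -> R) (p u v : R * R)
    (e : R) :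
  (\forall p' \near p, differentiable h p') ->
  differentiable (fun p => 'D_u h p) p -> 0 < e ->
  exists2 d : R, 0 < d & forall s : R, 0 < s < d ->
    `|h (s *: u + (s *: v + p)) - h (s *: u + p) - h (s *: v + p) + h p
      - s ^+ 2 * 'D_v (fun p => 'D_u h p) p| <= e * s ^+ 2.
Proof.
move=> /nbhs_normP[d1 /= d10 dh] dk e0.
set k := fun p => _ in dk *.
(* The two expansion points lie within [s] times |u| + |v| and [s] times |u| of [p]; [M] exceeds the
   sum of these two factors, and the 1 keeps it positive. *)
pose M := 2 * `|u| + `|v| + 1.
have M0 : 0 < M by rewrite /M; have := normr_ge0 u; have := normr_ge0 v; lra.
have eM : 0 < e / M by rewrite divr_gt0.
have [d2 d20 kb] := differentiable_bound dk eM.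
exists (Num.min d1 d2 / M); first by rewrite divr_gt0 // lt_min d10.
move=> s /andP[s0]; rewrite ltr_pdivlMr // lt_min => /andP[sd1 sd2].
have nb (x y : R) : 0 <= x <= s -> 0 <= y <= s -> `|x *: u + y *: v| <= s * M.
  move=> /andP[x0 xs] /andP[y0 ys]; apply: (le_trans (ler_normD _ _)).
  rewrite !normrZ !ger0_norm //.
  have : x * `|u| <= s * `|u| by rewrite ler_wpM2r.
  have : y * `|v| <= s * `|v| by rewrite ler_wpM2r.
  rewrite /M; have := mulr_ge0 (ltW s0) (normr_ge0 u); have := normr_ge0 u.
  nra.
have dhx (x y : R) : 0 <= x <= s -> 0 <= y <= s ->
    differentiable h (x *: u + (y *: v + p)).
  move=> xs ys; apply: dh; rewrite /= distrC addrA addrK.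
  exact: (le_lt_trans (nb _ _ xs ys)).
pose F t := h (t *: u + (s *: v + p)) - h (t *: u + p).
pose dF t := k (t *: u + (s *: v + p)) - k (t *: u + p).
have s0s : 0 <= s <= s by rewrite lexx ltW.
have s00 : 0 <= (0 : R) <= s by rewrite lexx ltW.
have Fd t : 0 <= t <= s -> is_derive t 1 F (dF t).
  move=> ts; apply: is_deriveB; apply: is_derive_line.
    exact: dhx.
  by have := dhx _ _ ts s00; rewrite scale0r add0r.
have [t|t|c] := @MVT R F dF 0 s s0.
- by rewrite in_itv /= => /andP[/ltW a /ltW b]; apply: Fd; rewrite a b.
- apply: derivable_within_continuous => x; rewrite in_itv /= => xs.
  by have := Fd x xs.
rewrite in_itv /= => /andP[c0 cs]; rewrite /F !scale0r !add0r subr0.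
have cs' : 0 <= c <= s by rewrite !ltW.
have E a b c' d : a - b - (c' - d) = a - b - c' + d :> R by ring.
rewrite E => ->.
have k1 := kb (c *: u + s *: v).
have k2 := kb (c *: u + 0 *: v).
have {}k1 := k1 (le_lt_trans (nb _ _ cs' s0s) sd2).
have {}k2 := k2 (le_lt_trans (nb _ _ cs' s00) sd2).
have n1 : `|c *: u + s *: v| <= s * (`|u| + `|v|).
  apply: (le_trans (ler_normD _ _)); rewrite !normrZ (ger0_norm (ltW c0)) (ger0_norm (ltW s0)).
  have := ler_wpM2r (normr_ge0 u) (ltW cs).
  lra.
have n2 : `|c *: u + 0 *: v| <= s * `|u|.
  rewrite scale0r addr0 normrZ (ger0_norm (ltW c0)).
  by have := ler_wpM2r (normr_ge0 u) (ltW cs); lra.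
rewrite deriveE //.
have e1 := le_trans k1 (ler_wpM2l (ltW eM) n1).
have e2 := le_trans k2 (ler_wpM2l (ltW eM) n2).
move: e1 e2; rewrite !linearD !linearZ /= !scale0r !addr0 -!addrA /dF.
set du := 'd k p u; set dv := 'd k p v; set a3 := k p.
set a1 := k (c *: u + (s *: v + p)); set a2 := k (c *: u + p).
rewrite /GRing.scale /=.
set z := e / M.
have zM : z * M = e by rewrite /z mulfVK // gt_eqF.
rewrite !ler_norml => /andP[? ?] /andP[? ?].
have up : a1 - a2 - s * dv <= z * (s * M) /\ - (z * (s * M)) <= a1 - a2 - s * dv.
  have : 0 < z * s by rewrite mulr_gt0.
  by rewrite /M; split; lra.
case: up => /(ler_wpM2r (ltW s0)) up1 /(ler_wpM2r (ltW s0)) up2.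
have -> : e = z * M by rewrite zM.
apply/andP; split; lra.
Qed.

(** Continuity of the second derivatives is not assumed; both mixed derivatives are limits of one
    and the same second difference divided by [s ^+ 2]. *)
Lemma partial12_sym (R : realType) (h : R * R -> R) (p : R * R) :
  twice_differentiable h p ->
  partial1 (partial2 h) p = partial2 (partial1 h) p.
Proof.
move=> [dh d1 d2]; apply/eqP; rewrite -subr_eq0 -normr_le0.
apply/ler_addgt0Pr => e e0; rewrite add0r.
have e20 : 0 < e / 2 by rewrite divr_gt0.
have [x x0 Hx] := second_difference_bound (0, 1) dh d1 e20.
have [y y0 Hy] := second_difference_bound (1, 0) dh d2 e20.
pose s := Num.min x y / 2.
have s0 : 0 < s by rewrite divr_gt0 // lt_min x0.
have sm : s < Num.min x y by rewrite /s ltr_pdivrMr // ltr_pMr ?lt_min ?x0 // ltr1n.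
have /Hx : 0 < s < x by rewrite s0 (lt_le_trans sm) // ge_min lexx.
have /Hy : 0 < s < y by rewrite s0 (lt_le_trans sm) // ge_min lexx orbT.
(* The far corners agree, so the two second differences coincide up to the order of their middle
   terms. *)
rewrite (_ : s *: (0, 1) + (s *: (1, 0) + p) = s *: (1, 0) + (s *: (0, 1) + p)); last first.
  by rewrite !addrA [_ *: _ + _ *: _]addrC.
have s20 : 0 < s ^+ 2 by rewrite exprn_gt0.
set D2 := 'D_(0, 1) _ p; set D1 := 'D_(1, 0) _ p.
rewrite -[partial1 (partial2 h) p]/D1 -[partial2 (partial1 h) p]/D2.
clearbody D1 D2; move: (h _) (h (_ *: (1, 0) + p)) (h (_ *: (0, 1) + p)) (h p).
move: (s ^+ 2) s20 => {s0 sm}s s0 A B B' h0.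
rewrite !ler_norml => /andP[? ?] /andP[? ?].
rewrite -(ler_pM2l s0) -(ler_pM2l s0 _ e).
by apply/andP; split; lra.
Qed.

(** * Interval functions in endpoint coordinates *)

Definition ends (R : realType) (a b : R) : R * R := ((a + b) / 2, b - a).

Lemma is_derive_left_end (R : realType) (h : R * R -> R) (a b : R) :
  differentiable h (ends a b) ->
  is_derive a 1 (fun s => h (ends s b))
    (partial1 h (ends a b) / 2 - partial2 h (ends a b)).
Proof.
have E s : ends s b = s *: (2^-1, -1) + (b / 2, b).
  by rewrite /ends; congr pair; rewrite /= /GRing.scale /=; field.
under [fun s => _]eq_fun do rewrite E.
move=> dh; have -> : partial1 h (ends a b) / 2 - partial2 h (ends a b) =
    'D_(2^-1, -1) h (ends a b) by rewrite derive_pair //; ring.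
by rewrite E in dh *; exact: is_derive_line.
Qed.

Lemma is_derive_right_end (R : realType) (h : R * R -> R) (a b : R) :
  differentiable h (ends a b) ->
  is_derive b 1 (fun s => h (ends a s))
    (partial1 h (ends a b) / 2 + partial2 h (ends a b)).
Proof.
have E s : ends a s = s *: (2^-1, 1) + (a / 2, - a).
  by rewrite /ends; congr pair; rewrite /= /GRing.scale /=; field.
under [fun s => _]eq_fun do rewrite E.
move=> dh; have -> : partial1 h (ends a b) / 2 + partial2 h (ends a b) =
    'D_(2^-1, 1) h (ends a b) by rewrite derive_pair //; ring.
by rewrite E in dh *; exact: is_derive_line.
Qed.

(* In terms of H (a, b) = h (ends a b), the two inequalities say that
   H_ab >= 0 and H_bb <= 0. *)
Definition curvature_le0 (R : realType) (h : R * R -> R) (L M : R) :=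
  forall a b, L <= a -> a < b -> b <= M ->
  [/\ twice_differentiable h (ends a b),
      - partial1 (partial1 h) (ends a b) + 4 * partial2 (partial2 h) (ends a b) <= 0 &
      partial1 (partial1 h) (ends a b) + 4 * partial1 (partial2 h) (ends a b) +
        4 * partial2 (partial2 h) (ends a b) <= 0].

Section curvature.
Context (R : realType) (h : R * R -> R) (L M : R).
Hypothesis hc : curvature_le0 h L M.

Let dh a b : L <= a -> a < b -> b <= M -> differentiable h (ends a b).
Proof. by move=> La ab bM; have [[+ _ _] _ _] := hc La ab bM; exact: nbhs_singleton. Qed.

(** By the chain rule H_ab = h11/4 + (h21 - h12)/2 - h22; symmetry removes the middle term and
    leaves a quarter of the first inequality. *)
Let mixed_ge0 (h11 h12 h21 h22 : R) : h12 = h21 -> - h11 + 4 * h22 <= 0 ->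
  h12 / 2 + h22 <= (h11 / 2 + h21) / 2.
Proof. by move=> ->; lra. Qed.

(** Likewise H_bb = h11/4 + h12 + h22, a quarter of the second inequality. *)
Let right_le0 (h11 h12 h21 h22 : R) : h12 = h21 ->
  h11 + 4 * h12 + 4 * h22 <= 0 -> (h11 / 2 + h21) * 2^-1 + (h12 / 2 + h22) <= 0.
Proof. by move=> ->; lra. Qed.

(** As a function of the right end, H_a has derivative H_ab >= 0. *)
Lemma left_derivative_homo a b c : L <= a -> a < b -> b <= c -> c <= M ->
  partial1 h (ends a b) / 2 - partial2 h (ends a b) <=
  partial1 h (ends a c) / 2 - partial2 h (ends a c).
Proof.
move=> La ab bc cM.
pose F s := partial1 h (ends a s) / 2 - partial2 h (ends a s).
pose dF s := (partial1 (partial1 h) (ends a s) / 2 + partial2 (partial1 h) (ends a s)) * 2^-1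
  - (partial1 (partial2 h) (ends a s) / 2 + partial2 (partial2 h) (ends a s)).
have Fd s : b <= s -> s <= c -> is_derive s 1 F (dF s).
  move=> bs sc; have [[_ d1 d2] _ _] := hc La (lt_le_trans ab bs) (le_trans sc cM).
  have i1 := is_derive_right_end d1; have i2 := is_derive_right_end d2.

  apply: is_deriveB.
  apply: is_derive_eq.
  by rewrite /GRing.scale /=; ring.
have := @MVT_segment R F dF b c bc.
case.
- by move=> x; rewrite in_itv /= => /andP[/ltW ? /ltW ?]; exact: Fd.
- apply: derivable_within_continuous => x; rewrite in_itv /= => /andP[bx xc].
  by have := Fd x bx xc.
move=> x; rewrite in_itv /= => /andP[bx xc] E.
rewrite -subr_ge0 -/(F c) -/(F b) E mulr_ge0 ?subr_ge0 // /dF.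
have [td c1 _] := hc La (lt_le_trans ab bx) (le_trans xc cM).
by move: (partial12_sym td) c1; exact: mixed_ge0.
Qed.

(** As a function of the right end, H_b has derivative H_bb <= 0. *)
Lemma right_derivative_homo a b c : L <= a -> a < b -> b <= c -> c <= M ->
  partial1 h (ends a c) / 2 + partial2 h (ends a c) <=
  partial1 h (ends a b) / 2 + partial2 h (ends a b).
Proof.
move=> La ab bc cM.
pose F s := partial1 h (ends a s) / 2 + partial2 h (ends a s).
pose dF s := (partial1 (partial1 h) (ends a s) / 2 + partial2 (partial1 h) (ends a s)) * 2^-1
  + (partial1 (partial2 h) (ends a s) / 2 + partial2 (partial2 h) (ends a s)).
have Fd s : b <= s -> s <= c -> is_derive s 1 F (dF s).
  move=> bs sc; have [[_ d1 d2] _ _] := hc La (lt_le_trans ab bs) (le_trans sc cM).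
  have i1 := is_derive_right_end d1; have i2 := is_derive_right_end d2.
  apply: is_deriveD.
  apply: is_derive_eq.
  by rewrite /GRing.scale /=; ring.
have := @MVT_segment R F dF b c bc.
case.
- by move=> x; rewrite in_itv /= => /andP[/ltW ? /ltW ?]; exact: Fd.
- apply: derivable_within_continuous => x; rewrite in_itv /= => /andP[bx xc].
  by have := Fd x bx xc.
move=> x; rewrite in_itv /= => /andP[bx xc] E.
rewrite -subr_le0 -/(F c) -/(F b) E mulr_le0_ge0 ?subr_ge0 // /dF.
have [td _ c1] := hc La (lt_le_trans ab bx) (le_trans xc cM).
by move: (partial12_sym td) c1; exact: right_le0.
Qed.

(** In the left end [s], the difference has derivative H_a(s, b) - H_a(s, c) >= 0. The strict
    [a < c] keeps [ends s c] nondegenerate for every [s] up to [a]. *)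
Lemma strong_subadditive_lt x a c b :
  L <= x -> x <= a -> a < c -> c <= b -> b <= M ->
  h (ends x b) - h (ends x c) <= h (ends a b) - h (ends a c).
Proof.
move=> Lx xa ac cb bM.
pose F s := h (ends s b) - h (ends s c).
pose dF s := (partial1 h (ends s b) / 2 - partial2 h (ends s b)) -
  (partial1 h (ends s c) / 2 - partial2 h (ends s c)).
have Fd s : x <= s -> s <= a -> is_derive s 1 F (dF s).
  move=> xs sa; have sc := le_lt_trans sa ac; have sb := lt_le_trans sc cb.
  by apply: is_deriveB; apply: is_derive_left_end; apply: dh => //;
    rewrite ?(le_trans Lx) // (le_trans cb).
have := @MVT_segment R F dF x a xa.
case.
- by move=> s; rewrite in_itv /= => /andP[/ltW ? /ltW ?]; exact: Fd.
- apply: derivable_within_continuous => s; rewrite in_itv /= => /andP[xs sa].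
  by have := Fd s xs sa.
move=> s; rewrite in_itv /= => /andP[xs sa] E.
rewrite -subr_ge0 -/(F a) -/(F x) E mulr_ge0 ?subr_ge0 // /dF.
by apply: left_derivative_homo => //; [exact: le_trans xs|exact: le_lt_trans sa _].
Qed.

(** What is added is the case [a = c], where [ends c c] is outside the curvature hypothesis: the
    strict case is applied at [s < c], the term [h (ends s c) >= 0] is dropped, and [s] tends to [c]
    from the left. *)
Lemma strong_subadditive x a c b :
  (forall p, 0 <= p.2 -> 0 <= h p) -> h (ends c c) = 0 ->
  L <= x -> x <= a -> a <= c -> c < b -> b <= M ->
  h (ends x b) + h (ends a c) <= h (ends a b) + h (ends x c).
Proof.
move=> h0 hcc Lx xa; rewrite le_eqVlt => /orP[/eqP ac|ac] cb bM; last first.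
  by have := strong_subadditive_lt Lx xa ac (ltW cb) bM; lra.
rewrite {}ac in xa *; rewrite {a}hcc addr0 -lerBlDr.
move: xa; rewrite le_eqVlt => /orP[/eqP <-|xc].
  by rewrite lerBlDr lerDl h0 //= subrr.
have Hc : h (ends s b) @[s --> c^'-] --> h (ends c b).
  apply: cvg_at_left_filter.
  apply: differentiable_continuous; apply/derivable1_diffP.
  by have := is_derive_left_end (dh (le_trans Lx (ltW xc)) cb bM).
apply: (cvgr_to_ge Hc); near=> s.
have xs : x <= s by apply: ltW; near: s; exact: nbhs_left_gt.
have sc : s < c by [].
have := strong_subadditive_lt Lx xs sc (ltW cb) bM.
have : 0 <= h (ends s c) by apply: h0; rewrite /= subr_ge0 ltW.
lra.
Unshelve. all: by end_near. Qed.

(** The chord slopes over [c, t] and [t, y] are derivatives at some [c1 <= c2], and the derivative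
    is nonincreasing. Clearing denominators admits [t = c] and [y = c]. *)
Lemma right_end_concave x c t y :
  L <= x -> x < c -> c <= t -> t <= y -> y <= M ->
  (t - c) * (h (ends x y) - h (ends x c)) <= (y - c) * (h (ends x t) - h (ends x c)).
Proof.
move=> Lx xc ct ty yM.
pose F s := h (ends x s).
pose dF s := partial1 h (ends x s) / 2 + partial2 h (ends x s).
have Fd s : c <= s -> s <= y -> is_derive s 1 F (dF s).
  move=> cs sy; apply: is_derive_right_end; apply: dh => //.
    exact: lt_le_trans cs.
  exact: le_trans yM.
have [||c1 + E1] := @MVT_segment R F dF c t ct.
- move=> s; rewrite in_itv /= => /andP[/ltW ? /ltW st].
  by apply: Fd => //; exact: le_trans ty.
- apply: derivable_within_continuous => s; rewrite in_itv /= => /andP[cs st].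
  by have := Fd s cs (le_trans st ty).
rewrite in_itv /= => /andP[cc1 c1t].
have [||c2 + E2] := @MVT_segment R F dF t y ty.
- move=> s; rewrite in_itv /= => /andP[/ltW ts /ltW ?].
  by apply: Fd => //; exact: le_trans ts.
- apply: derivable_within_continuous => s; rewrite in_itv /= => /andP[ts sy].
  by have := Fd s (le_trans ct ts) sy.
rewrite in_itv /= => /andP[tc2 c2y].
have d21 : dF c2 <= dF c1.
  apply: right_derivative_homo => //; first exact: lt_le_trans cc1.
    exact: le_trans tc2.
  exact: le_trans yM.
rewrite -/(F y) -/(F c) -/(F t) E1.
have -> : F y - F c = dF c2 * (y - t) + dF c1 * (t - c) by rewrite -E1 -E2; ring.
have : 0 <= (t - c) * (y - t) * (dF c1 - dF c2) by rewrite !mulr_ge0 ?subr_ge0.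
lra.
Qed.

End curvature.

(** * Geometry and measure of the Cantor set *)

Lemma ivalE (R : realType) (p : R * R) (x : R) :
  ival p x = (lend p <= x <= rend p) :> Prop.
Proof. by rewrite /ival /= in_itv. Qed.

Lemma ival_ends (R : realType) (a b : R) : ival (ends a b) = `[a, b]%classic.
Proof.
rewrite /ival /lend /rend /ends /=.
have -> : (a + b) / 2 - (b - a) / 2 = a by field.
by have -> : (a + b) / 2 + (b - a) / 2 = b by field.
Qed.

Lemma ends_ival (R : realType) (p : R * R) : ends (lend p) (rend p) = p.
Proof. by case: p => w d; rewrite /ends /lend /rend /=; congr pair; field. Qed.

Lemma lend_le_rend (R : realType) (p : R * R) : (lend p <= rend p) = (0 <= p.2).
Proof. by rewrite /lend /rend; apply/idP/idP; lra. Qed.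

Lemma word_branch (w w' : word) : size w = size w' -> w != w' ->
  exists j e k k', w = rcons j e ++ k /\ w' = rcons j (~~ e) ++ k'.
Proof.
elim: w w' => [|e w IH] [|e' w'] //= [sw].
have [<- ww'|ee' _] := eqVneq e e'; last first.
  by exists [::], e, w, w'; split => //=; congr cons; case: e e' ee' => [] [].
have [|j [f [k [k' [-> ->]]]]] := IH _ sw.
  by apply: contra_neq ww' => ->.
by exists (e :: j), f, k, k'.
Qed.

(** Words of length at most [n] are finitely many; the induction splits off the first letter. This
    will bound the gaps of the early levels from below. *)
Lemma uniform_lower_bound (R : realType) (f : word -> R) (n : nat) :
  (forall j, 0 < f j) ->
  exists2 d : R, 0 < d & forall j, (size j <= n)%N -> d <= f j.
Proof.
elim: n f => [|n IH] f f0.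
  by exists (f [::]) => // j; rewrite leqn0 => /nilP ->.
have [d0 d00 h0] := IH (fun j => f (false :: j)) (fun=> f0 _).
have [d1 d10 h1] := IH (fun j => f (true :: j)) (fun=> f0 _).
exists (Num.min (f [::]) (Num.min d0 d1)); first by rewrite !lt_min f0 d00.
case=> [_|[] j]; rewrite ?ge_min ?lexx //= ltnS => jn.
  by rewrite (h1 _ jn) !orbT.
by rewrite (h0 _ jn) orbT.
Qed.

Section cantor_geometry.
Context (R : realType) (C : set R) (I : word -> R * R).
Hypothesis hC : cantor_family C I.

Local Notation L w := (lend (I w)).
Local Notation M w := (rend (I w)).

Lemma cantor_le w : L w <= M w.
Proof. by rewrite lend_le_rend (cantor_nonempty hC). Qed.

Lemma cantor_child_sub w e : ival (I (rcons w e)) `<=` ival (I w).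
Proof.
move=> x xe; apply: (cantor_nested hC).
by case: e xe => xe; [right|left].
Qed.

Lemma cantor_sub w k : ival (I (w ++ k)) `<=` ival (I w).
Proof.
elim: k w => [|e k IH] w; first by rewrite cats0.
by rewrite -cat_rcons; apply: subset_trans (@cantor_child_sub w e).
Qed.

Lemma cantor_child_ends w e : L w <= L (rcons w e) /\ M (rcons w e) <= M w.
Proof.
have le := cantor_le (rcons w e).
have := @cantor_child_sub w e (L (rcons w e)).
have := @cantor_child_sub w e (M (rcons w e)).
by rewrite !ivalE !lexx le /= => /(_ isT)/andP[_ ->] /(_ isT)/andP[->].
Qed.

Lemma cantor_gap w : M (rcons w false) < L (rcons w true).
Proof.
rewrite ltNge; apply/negP => le.
suff : set0 (L (rcons w true)) by [].
rewrite -(cantor_disjoint hC w); split; rewrite /= ivalE ?lexx ?cantor_le //.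
by rewrite le (cantor_left hC) (cantor_child_ends w true).1.
Qed.

Lemma cantor_lt w : L w < M w.
Proof.
have [l0 m0] := cantor_child_ends w false.
have [l1 m1] := cantor_child_ends w true.
have := cantor_gap w; have := cantor_le (rcons w false).
have := cantor_le (rcons w true); lra.
Qed.

Lemma cantor_level_disjoint w w' x : size w = size w' ->
  ival (I w) x -> ival (I w') x -> w = w'.
Proof.
move=> sw wx w'x; apply/eqP; apply/negPn/negP => ww'.
have [j [e [k [k' [E E']]]]] := word_branch sw ww'.
move: wx w'x; rewrite {}E {}E' => /cantor_sub je /cantor_sub je'.
suff : set0 x by [].
by rewrite -(cantor_disjoint hC j); case: e je je'.
Qed.

Lemma cantor_level n x : C x -> exists2 w, size w = n & ival (I w) x.
Proof. by rewrite (cantor_eq hC) => /(_ n Logic.I)[w wn wx]; exists w. Qed.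

(** At a level whose intervals are shorter than [b - a], the two points have distinct codes; [j] is
    the common prefix before the first difference. Taking both codes at the same level [n] makes the
    errors at the two ends equal. *)
Lemma cantor_branch a b n (N : nat) : a < b -> C a -> C b ->
  (forall w, (N <= size w)%N -> M w - L w < b - a) -> (N <= n)%N ->
  exists j k k', [/\ size k = size k', (size j + 1 + size k = n)%N,
    ival (I (rcons j false ++ k)) a & ival (I (rcons j true ++ k')) b].
Proof.
move=> ab Ca Cb small Nn.
have [w wn wa] := cantor_level n Ca.
have [w' w'n w'b] := cantor_level n Cb.
have ww' : w != w'.
  apply: contraTneq ab => ww'; have := small w; rewrite wn => /(_ Nn).
  move: wa w'b; rewrite -ww' !ivalE; lra.
have [|j [e [k [k' [E E']]]]] := word_branch _ ww'; first by rewrite wn w'n.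
move: wn w'n wa w'b; rewrite E E' !size_cat !size_rcons => kn k'n wa w'b.
exists j, k, k'; split.
- by apply/eqP; rewrite -(eqn_add2l (size j).+1) kn k'n.
- by rewrite addn1.
(* The opposite order would put [b] to the left of the gap of [j] and [a] to the right of it. *)
all: suff e0 : e = false by move: wa w'b; rewrite e0.
all: case: e {E E'} wa w'b => // /cantor_sub + /cantor_sub.
all: rewrite !ivalE => /andP[a1 _] /andP[_ b1].
all: by have := cantor_gap j; lra.
Qed.

(** A compactness argument in the manner of Koenig: if the lengths do not tend to 0 uniformly, some
    infinite branch keeps length at least [e], and its intersection is a segment inside [C]. *)
Lemma cantor_size_cvg0 (e : R) : 0 < e ->
  exists N, forall w, (N <= size w)%N -> M w - L w < e.
Proof.
move=> e0; apply: contrapT => noN.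
(* A word is bad if it has arbitrarily long extensions of length at least [e]; badness passes to one
   of the two children. *)
pose bad w := forall n, exists2 k, (n <= size k)%N & e <= M (w ++ k) - L (w ++ k).
have bad0 : bad [::].
  move=> n; apply: contrapT => H; apply: noN; exists n => w nw.
  by rewrite ltNge; apply/negP => ew; apply: H; exists w.
have badS w : bad w -> exists b, bad (rcons w b).
  move=> bw; apply: contrapT => H.
  have bd b : exists n, forall k, (n <= size k)%N -> M (rcons w b ++ k) - L (rcons w b ++ k) < e.
    apply: contrapT => H'; apply: H; exists b => n.
    apply: contrapT => H''; apply: H'; exists n => k nk.
    by rewrite ltNge; apply/negP => ew; apply: H''; exists k.
  have [n0 h0] := bd false; have [n1 h1] := bd true.
  have [[|b k] //= + ek] := bw (maxn n0 n1).+1; rewrite ltnS geq_max => /andP[k0 k1].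
  move: ek; rewrite -cat_rcons leNgt; apply/negP/negPn.
  by case: b; [exact: h1|exact: h0].
have [u uP] : exists u : nat -> word,
    forall n, [/\ bad (u n), size (u n) = n & exists b, u n.+1 = rcons (u n) b].
  have /choice[f fP] : forall w : {w | bad w}, exists b, bad (rcons (sval w) b).
    by case=> w /=; exact: badS.
  pose next (w : {w | bad w}) := exist bad (rcons (sval w) (f w)) (fP w).
  pose g n := iter n next (exist bad [::] bad0).
  exists (fun n => sval (g n)) => n; split; first exact: (svalP (g n)).
    by elim: n => //= n IH; rewrite size_rcons IH.
  by exists (f (g n)).
have eu n : e <= M (u n) - L (u n).
  have [/(_ 0)[k _ ek] _ _] := uP n.
  have := @cantor_sub (u n) k (L (u n ++ k)); have := @cantor_sub (u n) k (M (u n ++ k)).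
  rewrite !ivalE !lexx cantor_le /= => /(_ isT)/andP[_ h1] /(_ isT)/andP[h2 _]; lra.
have Lmono n m : (n <= m)%N -> L (u n) <= L (u m) /\ M (u m) <= M (u n).
  elim: m => [|m IH]; first by rewrite leqn0 => /eqP ->.
  rewrite leq_eqVlt => /orP[/eqP ->//|]; rewrite ltnS => /IH[l1 m1].
  have [_ _ [b ->]] := uP m; have [l2 m2] := cantor_child_ends (u m) b.
  by split; [exact: le_trans l2|exact: le_trans m1].
(* Along the branch the left ends stay below [s] and the right ends above [s + e], so [s, s + e]
   lies in every [ival (I (u n))], against total disconnectedness. *)
pose s := sup (range (fun n => L (u n))).
have ub n : ubound (range (fun n => L (u n))) (M (u n) - e).
  move=> _ [m _ <-].
  have [l1 m1] := Lmono _ _ (leq_maxl n m); have [l2 m2] := Lmono _ _ (leq_maxr n m).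
  have := eu (maxn n m); lra.
have ne : range (fun n => L (u n)) !=set0 by exists (L (u 0)); exists 0.
have sL n : L (u n) <= s.
  by apply: ub_le_sup; [exists (M (u 0) - e)|exists n].
have sM n : s <= M (u n) - e by exact: ge_sup.
have sC : `[s, s + e]%classic `<=` C.
  move=> x /=; rewrite in_itv /= => /andP[sx xs]; rewrite (cantor_eq hC) => n _.
  exists (u n); first by have [_ ? _] := uP n.
  by rewrite ivalE (le_trans (sL n) sx) /=; have := sM n; lra.
have Cs : C s by apply: sC; rewrite /= in_itv /= lexx lerDl ltW.
have : connected_component C s (s + e).
  exists `[s, s + e]%classic; last by rewrite /= in_itv /= lexx lerDl ltW.
  split => //; first by rewrite /= in_itv /= lexx lerDl ltW.
  exact: segment_connected.
rewrite (cantor_totally_disconnected hC Cs) /=; lra.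
Qed.

End cantor_geometry.

(* The relative position, in C ordered from left to right, of the part of C
   lying to the left of the interval coded by k. *)
Fixpoint dyadic (R : realType) (k : word) : R :=
  if k is b :: k' then (b%:R + dyadic R k') / 2 else 0.

Lemma dyadic_ge0 (R : realType) (k : word) : 0 <= dyadic R k.
Proof. by elim: k => //= -[] k IH; rewrite divr_ge0 // addr_ge0. Qed.

Lemma measureU_le d (T : measurableType d) (R : realType)
    (mu : {measure set T -> \bar R}) (A B : set T) :
  measurable A -> measurable B -> (mu (A `|` B) <= mu A + mu B)%E.
Proof.
move=> mA mB; have mBA : measurable (B `\` A) by exact: measurableD.
rewrite (_ : A `|` B = A `|` (B `\` A)); last by rewrite setUDr setDv setD0.
rewrite measureU //; last by rewrite setDE setICA setICr setI0.
by rewrite leeD2l // le_measure ?inE //; exact: subDsetl.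
Qed.

Lemma half_expn_lt (R : realType) (e : R) (N : nat) : 0 < e ->
  exists2 n, (N <= n)%N & 2^-1 ^+ n < e.
Proof.
move=> e0; have [n _ nP] := near_infty_natSinv_expn_lt (PosNum e0).
exists (maxn n N); first exact: leq_maxr.
by have := nP (maxn n N) (leq_maxl n N); rewrite /= div1r exprVn.
Qed.

(** * Masses of the pieces of the Cantor set *)

Section cantor_measure.
Context (R : realType) (C : set R) (I : word -> R * R).
Context (nu : probability (measurableTypeR R) R).
Hypothesis hC : cantor_family C I.
Hypothesis hnu : cantor_measure C I nu.

Local Notation L w := (lend (I w)).
Local Notation M w := (rend (I w)).

Let measurable_ival (p : R * R) : measurable (ival p : set (measurableTypeR R)).
Proof. exact: measurable_itv. Qed.

Lemma measurable_cantor : measurable (C : set (measurableTypeR R)).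
Proof. exact: measurable_realfun.compact_measurable (cantor_compact hC). Qed.

(** [C] has full mass and lies in the interval of the empty word, which starts the halving. *)
Lemma cantor_measure_ival w : nu (ival (I w)) = (2^-1 ^+ size w)%:E.
Proof.
have nuC : (1 <= nu C)%E.
  have mC := measurable_cantor.
  have := probability_setC nu mC; rewrite (cantor_measure_support hnu).
  have : nu C \is a fin_num by exact: fin_num_measure.
  case: (nu C) => //= x _ [] /eqP.
  by rewrite lee_fin eq_sym subr_eq0 => /eqP ->.
elim/last_ind: w => [|w e IH].
  apply/eqP; rewrite eq_le expr0 probability_le1 ?measurable_ival //=.
  apply: (le_trans nuC).
  rewrite le_measure ?inE //; first exact: measurable_cantor.
  by move=> x /(cantor_level hC 0)[w /size0nil ->].
rewrite size_rcons exprS EFinM -IH.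
by case: e; rewrite ?(cantor_measure_left hnu) ?(cantor_measure_right hnu).
Qed.

(** The two children already carry the whole mass of [I w]. *)
Lemma cantor_measure_gap w : nu `]M (rcons w false), L (rcons w true)[%classic = 0%E.
Proof.
set G := `]_, _[%classic.
have mG : measurable (G : set (measurableTypeR R)) by exact: measurable_itv.
have gw := cantor_gap hC w.
have sub : G `|` (ival (I (rcons w false)) `|` ival (I (rcons w true))) `<=` ival (I w).
  move=> x [|[|]]; [|exact: (cantor_child_sub hC)|exact: (cantor_child_sub hC)].
  rewrite /G /= in_itv /= ivalE => /andP[x1 x2].
  have [a _] := cantor_child_ends hC w false.
  have [_ b] := cantor_child_ends hC w true.
  have := cantor_le hC (rcons w false); have := cantor_le hC (rcons w true).
  by move=> ? ?; apply/andP; split; lra.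
have mI := measurable_ival.
have mU : measurable
    (ival (I (rcons w false)) `|` ival (I (rcons w true)) : set (measurableTypeR R)).
  exact: measurableU.
have : (nu (G `|` (ival (I (rcons w false)) `|` ival (I (rcons w true)))) <= nu (ival (I w)))%E.
  by rewrite le_measure ?inE //; exact: measurableU.
have -> : (nu (G `|` (ival (I (rcons w false)) `|` ival (I (rcons w true)))) =
    nu G + (nu (ival (I (rcons w false))) + nu (ival (I (rcons w true)))))%E.
  rewrite measureU //; last first.
    by apply/seteqP; split => // x [] + []; rewrite /G /= in_itv /= ivalE; lra.
  congr (_ + _)%E; apply: measureU => //; exact: cantor_disjoint hC w.
rewrite !cantor_measure_ival !size_rcons.
have : nu G \is a fin_num by exact: fin_num_measure.
have : (0 <= nu G)%E by exact: measure_ge0.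
case: (nu G) => //= x; rewrite lee_fin => x0 _.
move=> le1; congr EFin; apply/eqP; rewrite eq_le x0 andbT.
have {le1} : x + (2^-1 ^+ (size w).+1 + 2^-1 ^+ (size w).+1) <= 2^-1 ^+ size w := le1.
by rewrite exprS; lra.
Qed.

Let mitv (i : interval R) : measurable ([set` i] : set (measurableTypeR R)).
Proof. exact: measurable_itv. Qed.

(** One step up the tree in the two estimates below: passing from a child to its parent adds the
    null gap and the whole sibling, which has half the mass of the parent. *)
Let child_measure j e (x : R) (A : set (measurableTypeR R)) :
  measurable A ->
  (nu A <= (2^-1 ^+ size (rcons j e) * x)%:E)%E ->
  (nu (A `|` (`]M (rcons j false), L (rcons j true)[%classic `|` ival (I (rcons j (~~ e)))))
    <= (2^-1 ^+ size j * ((1 + x) / 2))%:E)%E.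
Proof.
move=> mA Ax; set G := `]_, _[%classic; set B := ival _.
have mG : measurable (G : set (measurableTypeR R)) by exact: mitv.
have mB : measurable (B : set (measurableTypeR R)) by exact: measurable_ival.
have GB : (nu (G `|` B) <= (2^-1 ^+ (size j).+1)%:E)%E.
  have : (nu (G `|` B) <= nu G + nu B)%E by exact: measureU_le.
  by rewrite cantor_measure_gap add0e cantor_measure_ival size_rcons.
apply: (le_trans (measureU_le nu mA (measurableU _ _ mG mB))).
apply: (le_trans (leeD Ax GB)); rewrite size_rcons -EFinD lee_fin exprS.
by rewrite le_eqVlt; apply/orP; left; apply/eqP; field.
Qed.

(** Complementing letters reverses the order, so [dyadic R (map negb k)] is the relative mass to the
    right of the cell of [k]; the cell of [a] itself is counted in full, whence the extra power of
    1/2. *)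
Lemma cantor_measure_right_part j k a : ival (I (j ++ k)) a ->
  (nu `[a, M j]%classic <= (2^-1 ^+ size j * (dyadic R (map negb k) + 2^-1 ^+ size k))%:E)%E.
Proof.
elim: k j => [|e k IH] j; rewrite /= ?cats0.
  rewrite ivalE => /andP[La aM].
  rewrite add0r expr0 mulr1 -cantor_measure_ival le_measure ?inE //.
  by apply: subset_itv; rewrite bnd_simp.
rewrite -cat_rcons => ka; have {IH} := IH _ ka.
have := cantor_sub hC ka; rewrite ivalE.
(* After the letter 1, [a] is in the right child, which shares its right end with [I j]; only the
   letter 0 adds a sibling. *)
case: e {ka} => /andP[La aM] IH.
  rewrite -(cantor_right hC) (le_trans IH) // size_rcons lee_fin !exprS add0r.
  by rewrite le_eqVlt; apply/orP; left; apply/eqP; field.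
have := child_measure (mitv _) IH; rewrite /=.
rewrite addrA exprS (mulrC 2^-1 (_ ^+ _)) -mulrDl; apply: le_trans.
apply: le_measure; rewrite ?inE //; first by do 2 apply: measurableU => //.
move=> x; rewrite /= in_itv /= => /andP[ax xM].
have [xl|lx] := leP x (M (rcons j false)); first by left; rewrite in_itv /= ax.
right; have [xl|lx'] := ltP x (L (rcons j true)); first by left; rewrite in_itv /= lx.
by right; rewrite ivalE lx' (cantor_right hC).
Qed.

(** Mirror image of the previous estimate: here the letter 1 adds the left sibling. *)
Lemma cantor_measure_left_part j k b : ival (I (j ++ k)) b ->
  (nu `[L j, b]%classic <= (2^-1 ^+ size j * (dyadic R k + 2^-1 ^+ size k))%:E)%E.
Proof.
elim: k j => [|e k IH] j; rewrite /= ?cats0.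
  rewrite ivalE => /andP[La aM].
  rewrite add0r expr0 mulr1 -cantor_measure_ival le_measure ?inE //.
  by apply: subset_itv; rewrite bnd_simp.
rewrite -cat_rcons => kb; have {IH} := IH _ kb.
have := cantor_sub hC kb; rewrite ivalE.
case: e {kb} => /andP[Lb bM] IH; last first.
  rewrite -(cantor_left hC) (le_trans IH) // size_rcons lee_fin !exprS add0r.
  by rewrite le_eqVlt; apply/orP; left; apply/eqP; field.
have := child_measure (mitv _) IH; rewrite /=.
rewrite addrA exprS (mulrC 2^-1 (_ ^+ _)) -mulrDl; apply: le_trans.
apply: le_measure; rewrite ?inE //; first by do 2 apply: measurableU => //.
move=> x; rewrite /= in_itv /= => /andP[ax xM].
have [xl|lx] := leP (L (rcons j true)) x; first by left; rewrite in_itv /= xl.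
right; have [xl|lx'] := ltP (M (rcons j false)) x; first by left; rewrite in_itv /= xl.
by right; rewrite ivalE lx' (cantor_left hC) ax.
Qed.

Lemma cantor_measure_point a : nu `[a, a]%classic = 0%E.
Proof.
have ma : measurable (`[a, a]%classic : set (measurableTypeR R)) := mitv _.
have aS (A : set R) : A a -> `[a, a]%classic `<=` A.
  by move=> Aa x; rewrite /= in_itv /= -eq_le => /eqP <-.
have [Ca|nCa] := pselect (C a); last first.
  apply/eqP; rewrite eq_le measure_ge0 andbT -(cantor_measure_support hnu).
  rewrite le_measure ?inE //; first exact: measurableC measurable_cantor.
  exact: aS.
have bound n : (nu `[a, a]%classic <= (2^-1 ^+ n)%:E)%E.
  have [w <- wa] := cantor_level hC n Ca.
  by rewrite -cantor_measure_ival le_measure ?inE //; exact: aS.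
have : (0 <= nu `[a, a]%classic)%E by exact: measure_ge0.
have : nu `[a, a]%classic \is a fin_num by exact: fin_num_measure.
move: (nu _) bound => [x| |] // bound _; rewrite lee_fin => x0.
congr EFin; apply/eqP; rewrite eq_le x0 andbT.
apply/ler_addgt0Pr => e e0; rewrite add0r.
have [n _ /ltW ne] := half_expn_lt 0 e0.
by apply: le_trans ne; have := bound n; rewrite lee_fin.
Qed.

End cantor_measure.

(** * Lower bound on h *)

Lemma dyadic_le1 (R : realType) (k : word) : dyadic R k <= 1.
Proof. by elim: k => //= b k IH; rewrite ler_pdivrMr // mul1r lerD // lern1 leq_b1. Qed.

Lemma dyadic_nseq_false (R : realType) (m : nat) (k : word) :
  dyadic R (nseq m false ++ k) = dyadic R k / 2 ^+ m.
Proof.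
elim: m => [|m IH] /=; first by rewrite expr0 divr1.
by rewrite IH add0r exprS; field; rewrite expf_neq0.
Qed.

(** A gap joined to the interval on its right is half-open, so the supremum is not attained and is
    approached by points [t] close to [c]. *)
Lemma diam_itv_oc (R : realType) (c y : R) : c < y -> diam `]c, y]%classic = y - c.
Proof.
move=> cy; rewrite /diam; set S := [set z | _].
have ubS : ubound S (y - c).
  move=> _ [s [t [+ + ->]]]; rewrite /= !in_itv /= => /andP[? ?] /andP[? ?].
  by rewrite ler_norml; apply/andP; split; lra.
have S0 : S 0 by exists y, y; rewrite /= !in_itv /= cy lexx subrr normr0; split.
apply/eqP; rewrite eq_le ge_sup //=; last by exists 0.
apply/ler_addgt0Pr => e e0.
pose d := Num.min e (y - c); pose t := c + d / 2.
have d0 : 0 < d by rewrite lt_min e0 subr_gt0.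
have de : d <= e by rewrite ge_min lexx.
have dy : d <= y - c by rewrite ge_min lexx orbT.
rewrite -lerBlDr; apply: (@le_trans _ _ (y - t)); first by rewrite /t; lra.
apply: ub_le_sup; first by exists (y - c).
exists y, t; rewrite /= !in_itv /= cy lexx; split => //.
  by rewrite /t; apply/andP; split; lra.
by rewrite ger0_norm // /t; lra.
Qed.

Lemma gapE (R : realType) (C : set R) (I : word -> R * R) (w : word) :
  cantor_family C I ->
  gap I w = `]rend (I (rcons w false)), lend (I (rcons w true))[%classic.
Proof.
move=> hC; rewrite /gap; have gw := cantor_gap hC w.
have l0 := cantor_le hC (rcons w false); have l1 := cantor_le hC (rcons w true).
have Lw := cantor_left hC w; have Mw := cantor_right hC w.
apply/seteqP; split=> x /=; rewrite in_itv /=.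
  move=> [+ H]; rewrite !ivalE => /andP[Lx xM].
  apply/andP; split; rewrite ltNge; apply/negP => xe; apply: H; [left|right].
    by rewrite ivalE Lw Lx.
  by rewrite ivalE xe Mw.
move=> /andP[x1 x2]; split; first by rewrite ivalE -Lw -Mw; apply/andP; split; lra.
by move=> [|]; rewrite ivalE => /andP[? ?]; lra.
Qed.

Section good_words.
Context (R : realType) (C : set R) (I : word -> R * R) (h : R * R -> R).
Context (nu : probability (measurableTypeR R) R) (q r : R) (good : word -> Prop).
Hypothesis hC : cantor_family C I.
Hypothesis hnu : cantor_measure C I nu.
Hypothesis h_ge0 : forall p, 0 <= p.2 -> 0 <= h p.
Hypothesis h_eq0 : forall w, h (w, 0) = 0.

Local Notation L w := (lend (I w)).
Local Notation M w := (rend (I w)).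

Hypothesis good_child : forall j e, good j -> good (rcons j e).
Hypothesis good_curvature : forall j, good j -> curvature_le0 h (L j) (M j).
Hypothesis good_gap : forall j, good j -> forall m : nat,
  1 / 2 ^+ m <= diam (gap I j `|` ival (I (rcons j true ++ nseq m false))) /
                diam (gap I j `|` ival (I (rcons j true))).
Hypothesis good_size : forall j, good j ->
  q * 2^-1 ^+ size j <= h (I j) /\ h (I j) <= r * 2^-1 ^+ size j.

Local Notation kappa := (q - (r - q)).

Lemma good_cat j k : good j -> good (j ++ k).
Proof.
elim: k j => [|e k IH] j gj; first by rewrite cats0.
by rewrite -cat_rcons; apply: IH; exact: good_child.
Qed.

Lemma lend_cat_nseq j m : L (j ++ nseq m false) = L j.
Proof.
elim: m j => [|m IH] j; first by rewrite cats0.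
by rewrite -cat_rcons IH (cantor_left hC).
Qed.

(** This is (ii) with the diameters evaluated: appending zeros keeps the left end of I_{j1}, so the
    union with the gap is the half-open interval from the right end of I_{j0} to the right end of
    I_{j10^m}. *)
Lemma good_gapE j m : good j ->
  M j - M (rcons j false) <=
  2 ^+ m * (M (rcons j true ++ nseq m false) - M (rcons j false)).
Proof.
move=> gj; have gw := cantor_gap hC j.
have E n : diam (gap I j `|` ival (I (rcons j true ++ nseq n false))) =
    M (rcons j true ++ nseq n false) - M (rcons j false).
  have le := cantor_le hC (rcons j true ++ nseq n false).
  rewrite -diam_itv_oc; last by move: le; rewrite lend_cat_nseq; lra.
  congr diam; rewrite (gapE _ hC); apply/seteqP; split=> x /=; rewrite in_itv /=.
    by move=> [|]; rewrite ?in_itv /= ?ivalE; move: le; rewrite lend_cat_nseq; lra.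
  move=> /andP[cx xM]; have [xl|lx] := ltP x (L (rcons j true)).
    by left; rewrite in_itv /= cx.
  by right; rewrite ivalE lend_cat_nseq lx.
have := good_gap gj m; rewrite E.
have := E 0; rewrite cats0 => ->; rewrite (cantor_right hC).
have y0 : 0 < M j - M (rcons j false).
  by have := cantor_le hC (rcons j true); rewrite (cantor_right hC); lra.
rewrite ler_pdivlMr // mulrC mulrA ler_pdivrMr ?exprn_gt0 // mulr1.
by rewrite [X in _ <= X]mulrC.
Qed.

(* If k = 0^m 1 k', the claim for k' at the word j 1 0^m locates I_{j1k} between
   the right ends of I_{j10^(m+1)} and I_{j10^m}, which (ii) controls. *)
Lemma dyadic_le_position j k : good j ->
  dyadic R k * (M j - M (rcons j false)) <=
  L (rcons j true ++ k) - M (rcons j false).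
Proof.
have [n] := ubnP (size k); elim: n j k => // n IH j k kn gj.
have gw := cantor_gap hC j.
have [m [->|[k' E]]] : exists m, k = nseq m false \/ exists k', k = nseq m false ++ true :: k'.
  elim: k {kn} => [|[] k [m [->|[k' ->]]]]; first by exists 0; left.
  - by exists 0; right; exists (nseq m false).
  - by exists 0; right; exists (nseq m false ++ true :: k').
  - by exists m.+1; left.
  - by exists m.+1; right; exists k'.
  rewrite -[nseq m false]cats0 dyadic_nseq_false !mul0r cats0 lend_cat_nseq subr_ge0.
  exact: ltW.
pose j' := rcons j true ++ nseq m false.
have gj' : good j' by apply: good_cat; exact: good_child.
have k'n : (size k' < n)%N.
  by move: kn; rewrite E size_cat /= addnS ltnS; apply: leq_ltn_trans; exact: leq_addl.
have := IH j' k' k'n gj'.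
have -> : rcons j' true ++ k' = rcons j true ++ k by rewrite cat_rcons /j' E catA.
have -> : rcons j' false = rcons j true ++ nseq m.+1 false.
  by rewrite /j' -cats1 -catA; congr cat; rewrite cats1; elim: m {E j' gj'} => //= m ->.
have := good_gapE m gj; have := good_gapE m.+1 gj; rewrite -/j'.
rewrite E dyadic_nseq_false /= exprS.
have := dyadic_ge0 R k'; have := dyadic_le1 R k'.
set t := dyadic R k'; set c := M (rcons j false); set y := M j; set l := L _.
set y1 := M _; set y0 := M j'.
move=> t1 t0 ym1 ym0 le.
have P0 : 0 < 2 ^+ m :> R by rewrite exprn_gt0.
rewrite mulrAC ler_pdivrMr //.
have := ler_wpM2l (ltW P0) le.
(* The induction hypothesis reads l - c >= t (y0 - c) + (1 - t) (y1 - c); the two cases of (ii)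
   bound y0 - c by (y - c) / 2^m and y1 - c by half of that from below, and t + (1 - t) / 2 = (1 +
   t) / 2. *)
have s1 : 0 <= 1 - t by lra.
have := ler_wpM2l s1 ym1; have := ler_wpM2l t0 ym0.
move: (2 ^+ m) => P; lra.
Qed.

(** A letter 1 changes nothing. At a letter 0, strong subadditivity on [I j] and the left child adds
    h(I_j) - h(I_{j0}) >= q nu(I_j) - r nu(I_{j0}) = (2 q - r) nu(I_{j1}), which is where [kappa]
    comes from. The cell of [a] counts as 0. *)
Lemma h_right_part j k a : good j -> ival (I (j ++ k)) a ->
  kappa * 2^-1 ^+ size j * dyadic R (map negb k) <= h (ends a (M j)).
Proof.
elim: k j => [|e k IH] j gj; rewrite /= ?cats0.
  by rewrite ivalE mulr0 => /andP[La aM]; apply: h_ge0; rewrite /= subr_ge0.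
rewrite -cat_rcons => ka; have := IH _ (good_child e gj) ka.
have := cantor_sub hC ka; rewrite ivalE => /andP[La aM].
case: e {ka} La aM => La aM.
  rewrite (cantor_right hC) size_rcons exprS add0r; apply: le_trans.
  by rewrite le_eqVlt; apply/orP; left; apply/eqP; field.
have gw := cantor_gap hC j; have lw := cantor_le hC (rcons j true).
have Mw := cantor_right hC j; have Lw := cantor_left hC j.
have hcc : h (ends (M (rcons j false)) (M (rcons j false))) = 0.
  by rewrite /ends subrr h_eq0.
have := @strong_subadditive _ h _ _ (good_curvature gj) (L j) a (M (rcons j false)) (M j) h_ge0 hcc.
rewrite lexx -{1}Lw La aM lexx => /(_ isT isT isT _ isT).
have cM : M (rcons j false) < M j by rewrite -Mw (lt_le_trans gw).
move=> /(_ cM); rewrite ends_ival -{1}Lw ends_ival.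
have [+ _] := good_size gj; have [_ +] := good_size (good_child false gj).
rewrite size_rcons exprS.
move: (2^-1 ^+ size j) (dyadic R _) (h _) (h (I _)) (h (ends a _)) (h (I _)) => P t x1 x2 x3 x4.
by rewrite /= => ? ? ? ?; lra.
Qed.

(** The arithmetic of the two-sided bound: [c] and [y] are the right ends of I_{j0} and I_j, [l] is
    the left end of the cell of [b], and a pair of letters such as [xc] stands for the value of [h]
    on that interval. The sign of [kappa] matters when the lower bound for b - c is multiplied by
    it. *)
Let combine_parts (P t t' y c b l xc xy xb ac ab : R) :
  0 <= kappa -> 0 <= P -> 0 <= t' -> c <= b -> c < y -> l <= b ->
  t' * (y - c) <= l - c -> xc <= r * (2^-1 * P) -> q * P <= xy ->
  (b - c) * (xy - xc) <= (y - c) * (xb - xc) -> xb + ac <= ab + xc ->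
  kappa * (2^-1 * P) * t <= ac ->
  kappa * (2^-1 * P) * (t + t') <= ab.
Proof.
move=> kap0 P0 t'0 cb yc lb le1 le2 le3 le4 le5 le6.
have K0 : 0 <= kappa * (2^-1 * P) by rewrite !mulr_ge0.
have bc0 : 0 <= b - c by lra.
have KD : kappa * (2^-1 * P) <= xy - xc by lra.
have tb : t' * (y - c) <= b - c by lra.
have : (y - c) * (kappa * (2^-1 * P) * t') <= (y - c) * (xb - xc).
  apply: le_trans le4; apply: le_trans (ler_wpM2l bc0 KD).
  have := ler_wpM2r K0 tb; lra.
rewrite ler_pM2l; lra.
Qed.

Lemma h_both_parts j k k' a b : 0 <= kappa -> good j ->
  ival (I (rcons j false ++ k)) a -> ival (I (rcons j true ++ k')) b ->
  kappa * 2^-1 ^+ (size j).+1 * (dyadic R (map negb k) + dyadic R k') <=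
  h (ends a b).
Proof.
move=> kap0 gj ka kb.
have := h_right_part (good_child false gj) ka; rewrite size_rcons.
have /(_ k') := @dyadic_le_position j _ gj.
have := cantor_sub hC ka; rewrite ivalE => /andP[La aM].
have := cantor_sub hC kb; rewrite ivalE => /andP[Lb bM].
move: kb; rewrite ivalE => /andP[lb _].
have gw := cantor_gap hC j.
have Mw := cantor_right hC j; have Lw := cantor_left hC j.
have lw := cantor_le hC (rcons j false).
have hcc : h (ends (M (rcons j false)) (M (rcons j false))) = 0.
  by rewrite /ends subrr h_eq0.
have cb : M (rcons j false) < b by exact: lt_le_trans Lb.
have := @strong_subadditive _ h _ _ (good_curvature gj) (L j) a (M (rcons j false)) b h_ge0 hcc.
rewrite lexx -{1}Lw La aM cb -{1}Mw bM => /(_ isT isT isT isT isT).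
have xc : L j < M (rcons j false) by rewrite -Lw; exact: (cantor_lt hC).
have := @right_end_concave _ h _ _ (good_curvature gj) (L j) (M (rcons j false)) b (M j).
rewrite lexx xc (ltW cb) -{1}Mw bM lexx => /(_ isT isT isT isT isT).
have Ec : ends (L j) (M (rcons j false)) = I (rcons j false) by rewrite -Lw ends_ival.
rewrite ends_ival Ec.
have [+ _] := good_size gj; have [_ +] := good_size (good_child false gj).
rewrite size_rcons exprS => le1 le2 le3 le4 le5 le6.
apply: (combine_parts kap0 _ (dyadic_ge0 R k') (ltW cb) _ lb le5 le1 le2 le3 le4 le6).
  by rewrite exprn_ge0.
by lra.
Qed.

(** The bound on [h] ignores the cells of [a] and [b], while the bound on [nu] counts both in full.
    The error term is [kappa] times the mass of these two cells. *)
Lemma mass_le_h j k k' a b : 0 <= kappa -> good j -> size k = size k' ->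
  ival (I (rcons j false ++ k)) a -> ival (I (rcons j true ++ k')) b ->
  (kappa%:E * nu `[a, b]%classic <=
    (h (ends a b) + kappa * 2 * 2^-1 ^+ (size j + 1 + size k))%:E)%E.
Proof.
move=> kap0 gj kk ka kb.
have hab := h_both_parts kap0 gj ka kb.
have ra := cantor_measure_right_part hC hnu ka.
have rb := cantor_measure_left_part hC hnu kb.
set A := `[a, _]%classic in ra; set B := `[_, b]%classic in rb.
pose G := `]M (rcons j false), L (rcons j true)[%classic.
have mI (i : interval R) : measurable ([set` i] : set (measurableTypeR R)).
  exact: measurable_itv.
have mA : measurable (A : set (measurableTypeR R)) := mI _.
have mB : measurable (B : set (measurableTypeR R)) := mI _.
have mG : measurable (G : set (measurableTypeR R)) := mI _.
have nuG : nu G = 0%E := cantor_measure_gap hC hnu j.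
have sub : (nu `[a, b]%classic <= nu A + (nu G + nu B))%E.
  apply: (@le_trans _ _ (nu (A `|` (G `|` B)))).
    rewrite le_measure ?inE //; first by do 2 apply: measurableU => //.
    move=> x; rewrite /A /G /B /= !in_itv /= => /andP[-> ->].
    have [xM|Mx] := leP x (M (rcons j false)); first by left.
    by right; have [xL|Lx] := ltP x (L (rcons j true)); [left|right].
  apply: (@le_trans _ _ (nu A + nu (G `|` B))%E).
    by apply: measureU_le => //; exact: measurableU.
  by rewrite leeD2l //; exact: measureU_le.
have {}sub := le_trans sub (leeD (le_refl _) (leeD (le_refl _) rb)).
have {}sub := le_trans sub (leeD ra (le_refl _)).
move: sub; rewrite nuG add0e -EFinD => sub.
have k0 : (0 <= kappa%:E)%E by rewrite lee_fin.
apply: le_trans (lee_wpmul2l k0 sub) _.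
rewrite -EFinM lee_fin; move: hab; rewrite !size_rcons -kk addn1 exprD.
by move: (2^-1 ^+ _) (2^-1 ^+ _) => P Q hab; lra.
Qed.

End good_words.

(** * Hausdorff measure *)

Section mass_distribution.
Context (R : realType) (C : set R) (I : word -> R * R) (h : R * R -> R).
Context (nu : probability (measurableTypeR R) R) (kappa : R) (X : set R) (N0 : nat).
Context (good : word -> Prop).
Hypothesis hC : cantor_family C I.
Hypothesis hnu : cantor_measure C I nu.
Hypothesis h_ge0 : forall p, 0 <= p.2 -> 0 <= h p.
Hypothesis h_mono : forall p p', 0 <= p.2 -> 0 <= p'.2 ->
  ival p `<=` ival p' -> h p <= h p'.
Hypothesis kappa_ge0 : 0 <= kappa.
Hypothesis mX : measurable (X : set (measurableTypeR R)).
Hypothesis closedX : closed X.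
Hypothesis goodX : forall j x, (N0 <= size j)%N -> ival (I j) x -> X x -> good j.
Hypothesis good_mass : forall j k k' a b, good j -> size k = size k' ->
  ival (I (rcons j false ++ k)) a -> ival (I (rcons j true ++ k')) b ->
  (kappa%:E * nu `[a, b]%classic <=
    (h (ends a b) + kappa * 2 * 2^-1 ^+ (size j + 1 + size k))%:E)%E.

(** For fixed endpoints the level of the two cells is sent to infinity, which removes the error
    term. *)
Lemma mass_distribution_ends : exists2 d : R, 0 < d &
  forall a b, C a -> C b -> X a -> a <= b -> b - a < d ->
  (kappa%:E * nu `[a, b]%classic <= (h (ends a b))%:E)%E.
Proof.
have gap0 j : 0 < lend (I (rcons j true)) - rend (I (rcons j false)).
  by rewrite subr_gt0; exact: (cantor_gap hC).
(* Points of [C] that branch at a word of length at most [N0] are separated by its gap, hence by at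
   least [d]; closer points branch at a longer word, which is good because it meets [X]. *)
have [d d0 dgap] := uniform_lower_bound N0 gap0.
exists d => // a b Ca Cb Xa ab abd.
suff [N bound] : exists N, forall n, (N <= n)%N ->
    (kappa%:E * nu `[a, b]%classic <= (h (ends a b) + kappa * 2 * 2^-1 ^+ n)%:E)%E.
  have mab : measurable (`[a, b]%classic : set (measurableTypeR R)) by exact: measurable_itv.
  have : nu `[a, b]%classic \is a fin_num by exact: fin_num_measure.
  move: (nu _) bound => [x| |] // bound _; rewrite -EFinM lee_fin.
  apply/ler_addgt0Pr => e e0.
  (* The 1 keeps the divisor positive when [kappa] is 0. *)
  have ke0 : 0 < e / (kappa * 2 + 1) by rewrite divr_gt0 // ltr_wpDl // mulr_ge0.
  have [n /bound + ne] := half_expn_lt N ke0.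
  rewrite -EFinM lee_fin => /le_trans; apply; rewrite lerD2l.
  move: ne; rewrite ltr_pdivlMr; last by rewrite ltr_wpDl // mulr_ge0.
  have : 0 <= 2^-1 ^+ n :> R by rewrite exprn_ge0.
  move: (2^-1 ^+ n) => P P0; lra.
move: ab; rewrite le_eqVlt => /orP[/eqP <-|ab].
  exists 0 => n _; rewrite (cantor_measure_point hC hnu) mule0 lee_fin.
  by rewrite addr_ge0 ?mulr_ge0 ?exprn_ge0 ?h_ge0 //= subrr.
have [|N small] := cantor_size_cvg0 hC (_ : 0 < b - a); first by rewrite subr_gt0.
exists N => n Nn.
have [j [k [k' [kk <- ka kb]]]] := cantor_branch hC ab Ca Cb small Nn.
apply: (good_mass _ kk ka kb).
have ja : ival (I j) a by apply: (@cantor_child_sub _ _ _ hC _ false); exact: (cantor_sub hC ka).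
apply: (goodX _ ja Xa); apply: contraT; rewrite -ltnNge => /ltnW/dgap.
have := cantor_sub hC ka; have := cantor_sub hC kb.
rewrite !ivalE => /andP[? ?] /andP[? ?] ?; exfalso; lra.
Qed.

(** The mass distribution principle. The estimate is known only for endpoints in [C], so each
    covering interval is first shrunk to the convex hull of its part of [X] and [C]; monotonicity of
    [h] returns to the original interval. *)
Lemma mass_le_content (delta : R) : (forall a b, C a -> C b -> X a -> a <= b ->
    b - a <= delta -> (kappa%:E * nu `[a, b]%classic <= (h (ends a b))%:E)%E) ->
  (kappa%:E * nu X <= hausdorff_content h delta (X `&` C))%E.
Proof.
move=> mass; apply: le_ereal_inf_tmp => _ [D [V [[Vd cov] ->]]].
have mC := measurable_cantor hC.
have mV k : measurable (ival (V k) : set (measurableTypeR R)) by exact: measurable_itv.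
pose S k := C `&` (X `&` ival (V k)).
have mS k : measurable (S k : set (measurableTypeR R)).
  by do 2 apply: measurableI => //.
have Sh k : D k -> (kappa%:E * nu (S k) <= (h (V k))%:E)%E.
  move=> Dk; have /andP[Vk0 Vkd] := Vd k Dk.
  have [S0|Sne] := eqVneq (S k) set0.
    by rewrite S0 measure0 mule0 lee_fin h_ge0.
  have cS : compact (S k).
    apply: compact_closedI (cantor_compact hC) _; apply: closedI => //.
    exact: itv_closed.
  have {}Sne : S k !=set0 by apply/set0P.
  have ci (f : R -> R) : continuous f -> {within S k, continuous f}.
    exact: continuous_subspaceT.
  (* Compactness puts the ends of the convex hull in the set itself. *)
  have [b bS bmax] := compact_EVT_max Sne cS (ci id (fun x => cvg_id)).
  have [a aS amin] := compact_EVT_min Sne cS (ci id (fun x => cvg_id)).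
  have ab : a <= b by exact: bmax.
  move: (aS) (bS); rewrite !inE => -[Ca [Xa Va]] [Cb [Xb Vb]].
  move: (Va) (Vb); rewrite !ivalE => /andP[Va1 Va2] /andP[Vb1 Vb2].
  have abd : b - a <= delta by move: Va1 Vb2; rewrite /lend /rend; lra.
  have k0 : (0 <= kappa%:E)%E by rewrite lee_fin.
  apply: le_trans (le_trans (mass a b Ca Cb Xa ab abd) _); last first.
    rewrite lee_fin h_mono //= ?subr_ge0 // ival_ends => x.
    rewrite /= in_itv /= ivalE => /andP[? ?].
    by apply/andP; split; lra.
  apply: lee_wpmul2l => //; rewrite le_measure ?inE //.
  by move=> x xS; rewrite /= in_itv /= amin ?bmax ?inE.
have -> : nu X = nu (X `&` C).
  apply/eqP; rewrite eq_le; apply/andP; split; last first.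
    by rewrite le_measure ?inE //; exact: measurableI.
  have XC : measurable (X `&` C : set (measurableTypeR R)) by exact: measurableI.
  have mCC : measurable (~` C : set (measurableTypeR R)) by exact: measurableC.
  apply: (@le_trans _ _ (nu ((X `&` C) `|` ~` C))).
    rewrite le_measure ?inE //; first exact: measurableU.
    by move=> x Xx; have [Cx|nCx] := pselect (C x); [left|right].
  apply: (@le_trans _ _ (nu (X `&` C) + nu (~` C))%E); first exact: measureU_le.
  by rewrite (cantor_measure_support hnu) adde0.
(* Extension by the empty set turns the sum over [D] into a series over all naturals, as countable
   subadditivity requires. *)
pose F k := if k \in D then S k else set0.
have mF k : measurable (F k : set (measurableTypeR R)) by rewrite /F; case: ifP.
have XF : X `&` C `<=` \bigcup_k F k.
  move=> x [Xx Cx]; have [k Dk Vk] := cov x (conj Xx Cx).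
  by exists k => //; rewrite /F mem_set.
have mXC : measurable (X `&` C : set (measurableTypeR R)) by exact: measurableI.
have sub : (nu (X `&` C) <= \sum_(0 <= k <oo) nu (F k))%E.
  exact: measure_sigma_subadditive.
have k0 : (0 <= kappa%:E)%E by rewrite lee_fin.
apply: le_trans (lee_wpmul2l k0 sub) _.
rewrite -nneseriesZl; last by move=> i _; exact: measure_ge0.
have -> : (\esum_(k in D) (h (V k))%:E)%E = (\esum_(k in [set k | k \in D]) (h (V k))%:E)%E.
  by congr esum; apply/seteqP; split => k /=; rewrite inE.
rewrite -nneseries_esum; last first.
  by move=> k; rewrite inE => Dk; rewrite lee_fin h_ge0 //; have /andP[] := Vd k Dk.
rewrite [leRHS]eseries_mkcond; apply: lee_nneseries => [k _ _|k _].
  by apply: mule_ge0 => //; exact: measure_ge0.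
rewrite /F; case: ifPn; first by rewrite inE; exact: Sh.
by rewrite measure0 mule0.
Qed.

End mass_distribution.

Section hausdorff_bounds.
Context (R : realType) (h : R * R -> R) (E : set R).

Lemma hausdorff_content_ninc (d d' : R) : d <= d' ->
  (hausdorff_content h d' E <= hausdorff_content h d E)%E.
Proof.
move=> dd'; apply: ereal_inf_le_tmp => _ [D [V [[Vd cov] ->]]].
exists D, V; split => //; split => // k /Vd /andP[-> /le_trans]; exact.
Qed.

Lemma hausdorff_content_is_cvg : cvg (hausdorff_content h d E @[d --> 0^'+]).
Proof.
apply: nonincreasing_at_right_is_cvge; apply: nearW => x d d' _ _ dd'.
exact: hausdorff_content_ninc.
Qed.

Lemma hausdorff_measure_ge (d : R) (x : \bar R) : 0 < d ->
  (forall delta, 0 < delta -> delta < d -> (x <= hausdorff_content h delta E)%E) ->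
  (x <= hausdorff_measure h E)%E.
Proof.
move=> d0 H; apply: lime_ge; first exact: hausdorff_content_is_cvg.
near=> delta; apply: H; first by [].
by near: delta; exact: nbhs_right_lt.
Unshelve. all: by end_near. Qed.

Lemma hausdorff_measure_le (x : \bar R) :
  (forall delta, 0 < delta -> (hausdorff_content h delta E <= x)%E) ->
  (hausdorff_measure h E <= x)%E.
Proof.
move=> H; apply: lime_le; first exact: hausdorff_content_is_cvg.
by near=> delta; apply: H.
Unshelve. all: by end_near. Qed.

Lemma hausdorff_measure_ge0 : (forall p, 0 <= p.2 -> 0 <= h p) ->
  (0 <= hausdorff_measure h E)%E.
Proof.
move=> h0; apply: (@hausdorff_measure_ge 1) => // delta _ _.
apply: le_ereal_inf_tmp => _ [D [V [[Vd _] ->]]].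
by apply: esum_ge0 => k /Vd /andP[Vk _]; rewrite lee_fin h0.
Qed.

End hausdorff_bounds.

Lemma gauge_eq0 (R : realType) (h : R * R -> R) (w : R) : gauge h -> h (w, 0) = 0.
Proof.
move=> hh; apply/eqP; rewrite eq_le (gauge_ge0 hh) //= andbT.
apply: (cvgr_to_ge (gauge_cvg0 hh w)); near=> d.
have d0 : 0 < d by [].
apply: (gauge_increasing hh (p := (w, 0)) (p' := (w, d)) (lexx 0) (ltW d0)).
by move=> x; rewrite !ivalE /lend /rend /= => /andP[? ?]; apply/andP; split; lra.
Unshelve. all: by end_near. Qed.

(** Covering intervals that meet [J] may stick out of it by a small amount; continuity of [nu] from
    above removes the excess. *)
Lemma ival_neighborhood_measure (R : realType) (J : R * R)
    (nu : probability (measurableTypeR R) R) (x : \bar R) (r : R) : 0 <= r ->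
  (forall e, 0 < e -> (x <= r%:E * nu `[(lend J - e)%R, (rend J + e)%R]%classic)%E) ->
  (x <= r%:E * nu (ival J))%E.
Proof.
move=> r0 H.
pose F (n : nat) := `[(lend J - n.+1%:R^-1)%R, (rend J + n.+1%:R^-1)%R]%classic.
have mF n : measurable (F n : set (measurableTypeR R)) by exact: measurable_itv.
have FJ : \bigcap_n F n = ival J.
  apply/seteqP; split => [y Fy|y yJ n _]; last first.
    move: yJ; rewrite ivalE /F /= in_itv /= => /andP[? ?].
    have : 0 < n.+1%:R^-1 :> R by rewrite invr_gt0.
    by move: (n.+1%:R^-1) => z z0; apply/andP; split; lra.
  rewrite ivalE; apply/andP; split; apply/ler_addgt0Pr => e e0.
    have [n _ /(_ n (leqnn n))/= ne] := near_infty_natSinv_lt (PosNum e0).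
    have := Fy n Logic.I; rewrite /F /= in_itv /=; move: ne.
    by move: (n.+1%:R^-1) => z ze /andP[? ?]; lra.
  have [n _ /(_ n (leqnn n))/= ne] := near_infty_natSinv_lt (PosNum e0).
  have := Fy n Logic.I; rewrite /F /= in_itv /=; move: ne.
  by move: (n.+1%:R^-1) => z ze /andP[? ?]; lra.
have cv : (nu \o F) n @[n --> \oo] --> nu (ival J).
  rewrite -FJ; apply: nonincreasing_cvg_mu => //.
  - by rewrite (le_lt_trans (probability_le1 nu (mF 0))) // ltry.
  - by rewrite FJ; exact: measurable_itv.
  - move=> n m nm; apply/subsetPset; apply: subset_itv; rewrite bnd_simp.
      by rewrite lerD2l lerN2 lef_pV2 ?posrE // ler_nat.
    by rewrite lerD2l lef_pV2 ?posrE // ler_nat.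
have cvr : (r%:E * nu (F n))%E @[n --> \oo] --> (r%:E * nu (ival J))%E.
  by apply: cvgeZl.
rewrite -(cvg_lim _ cvr) //; apply: lime_ge; first by apply/cvg_ex; eexists; exact: cvr.
by apply: nearW => n; apply: H; rewrite invr_gt0.
Qed.

(** * The upper bound from the coverings by one level *)

Section upper_bound.
Context (R : realType) (C : set R) (I : word -> R * R) (h : R * R -> R).
Context (nu : probability (measurableTypeR R) R) (r : R) (J : R * R) (N0 : nat).
Hypothesis hC : cantor_family C I.
Hypothesis hnu : cantor_measure C I nu.
Hypothesis r_ge0 : 0 <= r.
Hypothesis h_le : forall j x, (N0 <= size j)%N -> ival (I j) x -> ival J x ->
  h (I j) <= r * 2^-1 ^+ size j.

(** The covering consists of the level-n intervals that meet [J]. They are disjoint and shorter than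
    [e], so their masses add up to the mass of a subset of the [e]-neighborhood of [J]. *)
Lemma content_le_mass (delta e : R) : 0 < delta -> 0 < e ->
  (hausdorff_content h delta (ival J `&` C) <=
    r%:E * nu `[(lend J - e)%R, (rend J + e)%R]%classic)%E.
Proof.
move=> d0 e0.
have m0 : 0 < Num.min delta e by rewrite lt_min d0.
have [N small] := cantor_size_cvg0 hC m0.
pose n := maxn N N0.
pose W : set word := [set w | size w = n /\ exists x, ival (I w) x /\ ival J x].
pose D : set nat := [set pickle w | w in W].
(* Words are numbered by [pickle]; the default [[::]] is never reached for indices in [D]. *)
pose V (k : nat) : R * R := I (odflt [::] (unpickle k)).
have VE w : V (pickle w) = I w by rewrite /V pickleK.
have mI w : measurable (ival w : set (measurableTypeR R)) by exact: measurable_itv.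
have smallW w : W w -> rend (I w) - lend (I w) < delta /\ rend (I w) - lend (I w) < e.
  move=> [wn _]; have := small w; rewrite wn leq_maxl => /(_ isT).
  by rewrite lt_min => /andP[].
have size2 p : rend p - lend p = p.2 :> R by rewrite /rend /lend; field.
apply: ge_ereal_inf; exists (\esum_(k in D) (h (V k))%:E)%E.
  exists D, V; split => //; split.
    move=> _ [w Ww <-]; rewrite VE (cantor_nonempty hC) /=.
    by have [+ _] := smallW w Ww; rewrite size2 => /ltW.
  move=> x [Jx Cx]; have [w wn wx] := cantor_level hC n Cx.
  exists (pickle w); last by rewrite VE.
  by exists w => //; split => //; exists x.
have DE : D = [set k | k \in D] by apply/seteqP; split => k /=; rewrite inE.
apply: (@le_trans _ _ (\esum_(k in D) (r%:E * nu (ival (V k))))%E).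
  apply: le_esum => _ [w [wn [x [wx Jx]]] <-].
  rewrite VE (cantor_measure_ival hC hnu) -EFinM lee_fin.
  by apply: (h_le _ wx Jx); rewrite wn leq_maxr.
rewrite DE -nneseries_esum; last by move=> k _; rewrite mule_ge0.
rewrite nneseriesZl //.
apply: lee_wpmul2l; first by rewrite lee_fin.
rewrite -(@measure_bigcup _ _ _ nu D (fun k => ival (V k))) //.
  rewrite le_measure ?inE //.
    exact: bigcup_measurable.
  move=> x [_ [w Ww <-]]; rewrite VE ivalE => /andP[? ?].
  have [_ we] := smallW w Ww.
  case: Ww => _ [y []]; rewrite !ivalE => /andP[? ?] /andP[? ?].
  by rewrite /= in_itv /=; apply/andP; split; lra.
move=> _ _ [w [wn _] <-] [w' [w'n _] <-] [x []].
by rewrite !VE => wx /(cantor_level_disjoint hC _ wx) ->; rewrite ?wn.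
Qed.

End upper_bound.

Theorem theorem2p2 (R : realType) (J : R * R) (eps : R)
    (h : R * R -> R) (C : set R) (I : word -> R * R)
    (nu : probability (measurableTypeR R) R) (q r : R)
    (hJ : 0 <= J.2) (hJ01 : ival J `<=` `[0, 1])
    (heps : 0 < eps)
    (hh : gauge h)
    (hC : cantor_family C I)
    (hnu : cantor_measure C I nu)
    (hi : exists2 delta0 : R, 0 < delta0 &
      forall w delta : R, 0 < delta < delta0 ->
        ival (w, delta) `<=` ival (dilate (1 + eps) J) ->
        let h11 := partial1 (partial1 h) in
        let h12 := partial1 (partial2 h) in
        let h22 := partial2 (partial2 h) in
        [/\ twice_differentiable h (w, delta),
            - h11 (w, delta) + 4 * h22 (w, delta) <= 0 &
            h11 (w, delta) + 4 * h12 (w, delta) + 4 * h22 (w, delta) <= 0])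
    (hii : for_long_words (fun j =>
      ival (I j) `<=` ival (dilate (1 + eps) J) ->
      forall m : nat,
        1 / 2 ^+ m <=
        diam (gap I j `|` ival (I (rcons j true ++ nseq m false))) /
        diam (gap I j `|` ival (I (rcons j true)))))
    (hq : 0 < q) (hr : 0 < r)
    (hiii : for_long_words (fun j =>
      ival (I j) `<=` ival (dilate (1 + eps) J) ->
      (q%:E * nu (ival (I j)) <= (h (I j))%:E)%E /\
      ((h (I j))%:E <= r%:E * nu (ival (I j)))%E)) :
  ((q - (r - q))%:E * nu (ival J) <= hausdorff_measure h (ival J `&` C))%E /\
  (hausdorff_measure h (ival J `&` C) <= r%:E * nu (ival J))%E.
Proof.
have h_ge0 := gauge_ge0 hh.
have h_eq0 w : h (w, 0) = 0 by exact: gauge_eq0.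
have mJ : measurable (ival J : set (measurableTypeR R)) by exact: measurable_itv.
have nuJ0 : (0 <= nu (ival J))%E by exact: measure_ge0.
(* A one-point [J] has no room around it in its dilation and is treated apart: [nu] has no atoms,
   and [J] covers itself at cost [h J = 0]. *)
have [J0|J0] := eqVneq J.2 0.
  have EJ : ival J = `[J.1, J.1]%classic.
    by rewrite /ival /lend /rend J0 mul0r subr0 addr0.
  have nuJ : nu (ival J) = 0%E by rewrite EJ; exact: (cantor_measure_point hC hnu).
  rewrite nuJ !mule0; split; first exact: hausdorff_measure_ge0.
  apply: hausdorff_measure_le => delta d0; apply: ge_ereal_inf.
  exists (\esum_(k in [set 0%N]) (h J)%:E)%E.
    exists [set 0%N], (fun=> J); split => //; split; first by move=> k _; rewrite J0 lexx ltW.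
    by move=> x [Jx _]; exists 0%N.
  by rewrite esum_set1 ?lee_fin ?h_ge0 // [J]surjective_pairing J0 h_eq0.
have {J0}J0 : 0 < J.2 by rewrite lt_neqAle eq_sym J0.
case: hi => delta0 delta00 {}hi; case: hii => k2 {}hii; case: hiii => k3 {}hiii.
(* Below [delta0], (i) applies to every nondegenerate subinterval of a good interval;
   [eps * J.2 / 2] is the margin of the dilation on each side of [J], so a shorter interval meeting
   [J] stays inside the dilation. *)
have m0 : 0 < Num.min delta0 (eps * J.2 / 2).
  by rewrite lt_min delta00 divr_gt0 // mulr_gt0.
have [N small] := cantor_size_cvg0 hC m0.
pose n0 := maxn N (maxn k2 k3).
pose good (j : word) := (n0 <= size j)%N /\ ival (I j) `<=` ival (dilate (1 + eps) J).
have goodN j : good j -> [/\ (N <= size j)%N, (k2 <= size j)%N & (k3 <= size j)%N].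
  by case; rewrite !geq_max => /andP[-> /andP[-> ->]].
have goodJ j x : (n0 <= size j)%N -> ival (I j) x -> ival J x -> good j.
  move=> jn jx Jx; split => // y; move: jx Jx; rewrite !ivalE => /andP[? ?] /andP[? ?] /andP[? ?].
  have := small j; rewrite (leq_trans _ jn) ?leq_maxl // => /(_ isT).
  rewrite lt_min => /andP[_ ?].
  have : lend (dilate (1 + eps) J) = lend J - eps * J.2 / 2.
    by rewrite /lend /dilate /=; field.
  have : rend (dilate (1 + eps) J) = rend J + eps * J.2 / 2.
    by rewrite /rend /dilate /=; field.
  by move=> -> ->; apply/andP; split; lra.
have good_child j e : good j -> good (rcons j e).
  move=> [jn jJ]; split; first by rewrite size_rcons leqW.
  by apply: subset_trans jJ; exact: (cantor_child_sub hC).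
have good_size j : good j ->
    q * 2^-1 ^+ size j <= h (I j) /\ h (I j) <= r * 2^-1 ^+ size j.
  move=> gj; have [_ _ j3] := goodN _ gj; have := hiii _ j3 gj.2.
  by rewrite (cantor_measure_ival hC hnu) -!EFinM !lee_fin.
have good_gap j (gj : good j) := let: And3 _ j2 _ := goodN _ gj in hii j j2 gj.2.
have good_curv j : good j -> curvature_le0 h (lend (I j)) (rend (I j)).
  move=> gj a b La ab bM; have [jN _ _] := goodN _ gj.
  have := small j jN; rewrite lt_min => /andP[jd _].
  apply: hi; first by rewrite subr_gt0 ab /=; lra.
  apply: subset_trans gj.2; rewrite -/(ends a b) ival_ends => x.
  by rewrite /= in_itv /= ivalE => /andP[? ?]; apply/andP; split; lra.
split; last first.
  apply: hausdorff_measure_le => delta d0.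
  apply: ival_neighborhood_measure; first exact: ltW.
  have h_le j x : (n0 <= size j)%N -> ival (I j) x -> ival J x ->
      h (I j) <= r * 2^-1 ^+ size j.
    by move=> jn jx Jx; have [] := good_size _ (goodJ _ _ jn jx Jx).
  move=> e e0; exact: (content_le_mass hC hnu (ltW hr) h_le d0 e0).
(* For negative [kappa] the left side is at most 0 and the lower bound is trivial. *)
have [kap0|kap0] := leP 0 (q - (r - q)); last first.
  apply: (@le_trans _ _ 0%E); last exact: hausdorff_measure_ge0.
  by apply: mule_le0_ge0 => //; rewrite lee_fin ltW.
have closedJ : closed (ival J) by exact: itv_closed.
have mass := mass_le_h hC hnu h_ge0 h_eq0 good_child good_curv good_gap good_size kap0.
have [d d0 md] := mass_distribution_ends hC hnu h_ge0 kap0 goodJ mass.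
apply: (hausdorff_measure_ge d0) => delta delta_gt0 delta_d.
apply: (mass_le_content hC hnu h_ge0 (gauge_increasing hh) kap0 mJ closedJ) => a b Ca Cb Ja ab abd.
by apply: md => //; exact: le_lt_trans delta_d.
Qed.
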